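(* Suppose that $T_i:\mathbb{R}^n\to\mathbb{R}^n$ is paracontractive for every $i\in I$, and assume $C\neq\emptyset$. Then the sequence $(X_k)_{k\in\mathbb{N}_0}$ of random variables generated by $X_0\sim\mu$, $X_{k+1}=T_{\xi_k}X_k$, converges almost surely to a random variable $X_\mu\in C$ (depending on the initial distribution $\mu$).
   Context: Setting: $G=\mathbb{R}^n$ with the Euclidean norm $\|\cdot\|$ and Borel $\sigma$-algebra $\mathcal{B}(G)$; $(I,\mathcal{I})$ is a measurable space; $(T_i)_{i\in I}$ is a family of continuous maps $T_i:G\to G$ such that $\Phi:G\times I\to G$, $\Phi(x,i)=T_ix$, is measurable. $(\Omega,\mathcal{F},\mathbb{P})$ is a probability space, $\xi:\Omega\to I$ is measurable, and $(\xi_k)_{k\in\mathbb{N}_0}$ are i.i.d. with the same distribution as $\xi$. $\mu$ is a probability measure on $(G,\mathcal{B}(G))$, $X_0$ is a $G$-valued random variable with law $\mu$, and $X_0,\xi_0,\dots,\xi_k$ are independent for every $k\in\mathbb{N}_0$. The random function iteration is $X_{k+1}=T_{\xi_k}X_k$, $k\in\mathbb{N}_0$. $\operatorname{Fix}T_i=\{x\in G: T_ix=x\}$ and $C:=\{x\in G:\mathbb{P}(x\in\operatorname{Fix}T_\xi)=1\}$; the standing assumption is $C\ne\emptyset$. $T_i$ is paracontractive if it is continuous and $\|T_ix-y\|<\|x-y\|$ for all $x\notin\operatorname{Fix}T_i$ and all $y\in\operatorname{Fix}T_i$. *)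

(* Defs.v *)
From HB Require Import structures.
From mathcomp Require Import all_boot all_order all_algebra finmap.
From mathcomp Require Import all_classical all_reals all_analysis.

Set Implicit Arguments.
Unset Strict Implicit.
Unset Printing Implicit Defensive.

Import Order.TTheory GRing.Theory Num.Theory.
Import numFieldNormedType.Exports.

Local Open Scope classical_set_scope.
Local Open Scope ring_scope.

(* The Borel sigma-algebra on matrices, in particular on R^n = 'rV[R]_n. *)
HB.instance Definition _ (R : realType) (m n : nat) :=
  @isMeasurable.Build (sigma_display (@open 'M[R]_(m, n))) 'M[R]_(m, n)
    <<s (@open 'M[R]_(m, n)) >>
    (@sigma_algebra0 _ setT _) (@sigma_algebraC _ _)
    (@sigma_algebra_bigcup _ setT _).

(* The library's norm `|x| on 'rV[R]_n is the sup norm; the two norms induce  *)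
(* the same topology, so the library's notions of continuity, convergence and *)
(* open set apply unchanged.                                                  *)
Definition enorm {R : realType} {n : nat} (x : 'rV[R]_n) : R :=
  Num.sqrt (\sum_(j < n) x ord0 j ^+ 2).

Definition Fix {U : Type} (f : U -> U) : set U := [set x | f x = x].

Definition paracontractive {R : realType} {n : nat}
    (f : 'rV[R]_n -> 'rV[R]_n) : Prop :=
  continuous f /\
  forall x y, ~ Fix f x -> Fix f y -> enorm (f x - y) < enorm (x - y).

(* C = {x | P(x \in Fix T_xi) = 1} *)
Definition common_fix {R : realType} {n : nat} {dI dO : measure_display}
    {I : measurableType dI} {Omega : measurableType dO}
    (P : probability Omega R) (T : I -> 'rV[R]_n -> 'rV[R]_n)
    (xi : Omega -> I) : set 'rV[R]_n :=
  [set x | P [set w | Fix (T (xi w)) x] = 1%E].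

Fixpoint rfi {R : realType} {n : nat} {I Omega : Type}
    (T : I -> 'rV[R]_n -> 'rV[R]_n) (X0 : Omega -> 'rV[R]_n)
    (xi : nat -> Omega -> I) (k : nat) (w : Omega) : 'rV[R]_n :=
  if k is k'.+1 then T (xi k' w) (rfi T X0 xi k' w) else X0 w.

(* Mutual independence of a family of sets of events: the product rule holds  *)
(* over every finite subfamily.                                               *)
Definition mutually_independent {R : realType} {dO : measure_display}
    {Omega : measurableType dO} (P : probability Omega R)
    {J : choiceType} (F : J -> set (set Omega)) : Prop :=
  forall (D : {fset J}) (E : J -> set Omega),
    (forall j, j \in D -> F j (E j)) ->
    P (\bigcap_(j in [set` D]) E j) = (\prod_(j <- D) P (E j))%E.

(* sigma(X_0), sigma(xi_0), ..., sigma(xi_k), with None the index of X_0.     *)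
Definition sigma_X0_xi {R : realType} {n : nat} {dI dO : measure_display}
    {I : measurableType dI} {Omega : measurableType dO}
    (X0 : Omega -> 'rV[R]_n) (xi : nat -> Omega -> I) (k : nat)
    (j : option 'I_k.+1) : set (set Omega) :=
  if j is Some i then g_sigma_algebra_preimage (xi i)
  else g_sigma_algebra_preimage X0.
Arguments sigma_X0_xi {R n dI dO I Omega} X0 xi k j.

(* Main.v *)
(* Fix [y] in C and let [prox y x = 1 / (1 + |x - y|)]. As [y] is almost surely
   a fixed point, [prox y] does not decrease along the iteration, and its mean
   one-step increase (the drift) at [x] vanishes only if [x] is in C. Since
   [xi_k] is independent of [X_k] and [prox y <= 1], the expected drifts along
   [X_k] have sum at most 1, so the drift at [X_k] tends to 0 almost surely. The
   drift is continuous, hence every limit point of [X_k] is in C. Almost surely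
   all points of a countable dense subset of C, hence all of C, are fixed by
   every [T_(xi_k)]; the distance from [X_k] to a limit point in C is then
   nonincreasing, and so it tends to 0. *)
Require Import Defs.
From HB Require Import structures.
From mathcomp Require Import all_boot all_order all_algebra finmap.
From mathcomp Require Import all_classical all_reals all_analysis.
From mathcomp Require Import measurable_realfun.

Set Implicit Arguments.
Unset Strict Implicit.
Unset Printing Implicit Defensive.

Import Order.TTheory GRing.Theory Num.Theory.
Import numFieldNormedType.Exports.

Local Open Scope classical_set_scope.
Local Open Scope ring_scope.

(** * Measurability and separability in matrix spaces *)

Lemma open_measurable_mx (R : realType) (m n : nat) (A : set 'M[R]_(m, n)) :
  open A -> measurable A.
Proof. exact: sub_sigma_algebra. Qed.

Lemma closed_set1_mx (R : realType) (m n : nat) (x : 'M[R]_(m, n)) :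
  closed [set x].
Proof.
by apply: accessible_closed_set1; apply: hausdorff_accessible;
  exact: norm_hausdorff.
Qed.

Lemma measurable_set1_mx (R : realType) (m n : nat) (x : 'M[R]_(m, n)) :
  measurable [set x].
Proof.
rewrite -[X in measurable X]setCK; apply: measurableC; apply: open_measurable_mx.
by rewrite openC; exact: closed_set1_mx.
Qed.

Lemma continuous_measurable_mx (R : realType) (m n : nat)
    (f : 'M[R]_(m, n) -> R) : continuous f -> measurable_fun setT f.
Proof.
move=> /continuousP cf; apply: (measurability _ (RGenOpens.measurableE R)).
move=> _ [_ [a [b ->] <-]]; rewrite setTI; apply: open_measurable_mx.
exact/cf/interval_open.
Qed.

(** The limit lies in an open [U] iff, for some [p], the sequence is eventually in [V p], the
    interior of the set of points whose ball of radius [1/(p+1)] lies in [U]. This expresses the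
    preimage of [U] by countable unions and intersections of measurable sets. *)
Lemma measurable_fun_cvg_mx (R : realType) (m n : nat) d (S : measurableType d)
    (f_ : nat -> S -> 'M[R]_(m, n)) (f : S -> 'M[R]_(m, n)) :
  (forall k, measurable_fun setT (f_ k)) ->
  (forall s, f_ k s @[k --> \oo] --> f s) -> measurable_fun setT f.
Proof.
move=> mf_ f_f; apply: (measurability (@open 'M[R]_(m, n))) => //.
move=> _ [U oU <-]; rewrite setTI.
pose V p := [set x : 'M[R]_(m, n) | ball x p.+1%:R^-1 `<=` U]°.
have -> : f @^-1` U = \bigcup_p \bigcup_N
    \bigcap_(k in [set k | (N <= k)%N]) (f_ k @^-1` V p).
  apply/seteqP; split => s /=.
    move=> Ufs; have /nbhs_ballP[e /= e0 eU] : nbhs (f s) U by exact: open_nbhs_nbhs.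
    have [p _ pe] : \forall p \near \oo, p.+1%:R^-1 < e / 2 :> R.
      by apply: (near_infty_natSinv_lt (PosNum (divr_gt0 e0 (ltr0n _ 2)))).
    (* Since [1/(p+1) < e/2], every point of the ball of this radius about [f s] has its own such
       ball inside [U], so [f s] is an interior point. *)
    have Vfs : V p (f s).
      apply/nbhs_ballP; exists p.+1%:R^-1 => //= x fsx y xy.
      apply: eU; rewrite [e]splitr; apply: (ball_triangle (y := x)).
        by apply: le_ball fsx; apply/ltW/pe => /=.
      by apply: le_ball xy; apply/ltW/pe => /=.
    have [N _ NV] := f_f s _ (open_nbhs_nbhs (conj (open_interior _) Vfs)).
    by exists p => //; exists N => // k /= Nk; exact: NV.
  move=> [p _ [N _ NV]].
  have [K _ KV] := f_f s _ (nbhsx_ballx (f s) p.+1%:R^-1 (ltac:(by []))).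
  move: (NV (maxn N K) (leq_maxl _ _)) => /interior_subset /=.
  by apply; apply: ball_sym; apply: KV => /=; exact: leq_maxr.
apply: bigcupT_measurable => p; apply: bigcupT_measurable => N.
apply: bigcap_measurable => [|k _]; first by exists N => /=.
rewrite -[X in measurable X]setTI; apply: mf_ => //.
by apply: open_measurable_mx; exact: open_interior.
Qed.

(* Separability of [C]: the sequence is dense in [C]. *)
Lemma closed_cover_sequence_mx (R : realType) (m n : nat)
    (C : set 'M[R]_(m, n)) : C !=set0 ->
  exists2 s : nat -> 'M[R]_(m, n), forall k, C (s k) &
    forall F, closed F -> (forall k, F (s k)) -> C `<=` F.
Proof.
move=> [y0 Cy0].
(* There are countably many pairs of a rational matrix and a radius [1/(p+1)]; [g] picks a point of
   [C] in the corresponding ball, with default [y0] when there is none. *)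
pose B (c : 'M[rat]_(m, n) * nat) : set 'M[R]_(m, n) :=
  C `&` ball (map_mx ratr c.1 : 'M[R]_(m, n)) c.2.+1%:R^-1.
pose g c := if pselect (B c !=set0) is left e then xget y0 (B c) else y0.
have gC c : C (g c).
  by rewrite /g; case: pselect => // e; have [] := xgetPex y0 e.
pose s k := oapp g y0 (@choice.unpickle ('M[rat]_(m, n) * nat)%type k).
exists s => [k|]; first by rewrite /s; case: choice.unpickle => //= c.
move=> F Fc Fs x Cx; apply: Fc => A /nbhs_ballP[e /= e0 eA].
have [p _ pe] : \forall p \near \oo, p.+1%:R^-1 < e / 2 :> R.
  by apply: (near_infty_natSinv_lt (PosNum (divr_gt0 e0 (ltr0n _ 2)))).
have {}pe := pe p (leqnn p).
have p0 : 0 < p.+1%:R^-1 :> R by [].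
have [q qx] : exists q : 'M[rat]_(m, n), ball (map_mx ratr q : 'M[R]_(m, n)) p.+1%:R^-1 x.
  have H i j : exists r : rat, `|x i j - ratr r| < p.+1%:R^-1.
    have [r] := rat_in_itvoo (ltr_pwDr p0 (lexx (x i j))).
    rewrite in_itv /= => /andP[r1 r2]; exists r.
    by rewrite ltr_distlC r2 andbT (lt_trans _ r1)// ltrBlDr ltrDl.
  have [q qP] := choice (fun ij => H ij.1 ij.2).
  exists (\matrix_(i, j) q (i, j)); split => // i j; rewrite !mxE.
  by rewrite /ball /= distrC; exact: qP (i, j).
(* As [x] itself is in [B (q, p)], the point picked there is not the default; both lie within [e/2]
   of [q]. *)
have Bx : B (q, p) !=set0 by exists x.
have := Fs (choice.pickle (q, p)); rewrite /s choice.pickleK /= /g.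
case: pselect => // e1 Fg.
have [_ /= gq] := xgetPex y0 e1.
exists (xget y0 (B (q, p))); split => //; apply: eA; rewrite [e]splitr.
apply: (ball_triangle (y := map_mx ratr q : 'M[R]_(m, n))).
  by apply/ball_sym/(le_ball (ltW pe)).
exact: (le_ball (ltW pe)).
Qed.

(** * Independence of the current iterate from the later indices *)

(** Finite product measures are determined by rectangles. Carrying the event [E] along lets
    [rfi_indep] pass from [X k] and [xis k] to a function of both while keeping independence from
    the later indices. *)
Lemma pair_distribution_restr (R : realType) dO d1 d2
    (Omega : measurableType dO) (S1 : measurableType d1)
    (S2 : measurableType d2) (P : probability Omega R)
    (X : {RV P >-> S1}) (Y : {RV P >-> S2}) (E : set Omega) :
  measurable E ->
  (forall A B, measurable A -> measurable B ->
    P (X @^-1` A `&` Y @^-1` B `&` E) =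
    (P (X @^-1` A) * (P (Y @^-1` B) * P E))%E) ->
  forall D, measurable D ->
    P ((fun w => (X w, Y w)) @^-1` D `&` E) =
    ((distribution P X \x distribution P Y) D * P E)%E.
Proof.
move=> mE indep D mD.
have PE_fin : P E \is a fin_num by exact: fin_num_measure.
(* The factor [P E] is absorbed into the second marginal, so that the restriction of [P] to [E]
   pushes forward to a genuine product measure. *)
pose c : {nonneg R} := NngNum (fine_ge0 (measure_ge0 P E)).
have cE : (c%:num)%:E = P E by rewrite /= fineK.
have mXY : measurable_fun setT (fun w => (X w, Y w)).
  by apply: measurable_fun_pair; exact: measurable_funPT.
have := @product_measure_unique _ _ _ _ R (distribution P X)
  (mscale c (distribution P Y)) (pushforward (mrestr P mE) (fun w => (X w, Y w))).
move=> /(_ mXY) prodE; rewrite -[LHS]/(pushforward (mrestr P mE) (fun w => (X w, Y w)) D).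
rewrite -prodE//.
- rewrite /product_measure1 [in RHS]muleC -ge0_integralZl//.
  + by apply: eq_integral => x _; rewrite /mscale -cE.
  + exact: measurable_fun_xsection.
- move=> A B mA mB; apply: etrans (indep _ _ mA mB) _; congr (_ * _)%E.
  by rewrite muleC -cE.
Qed.

Section random_function_iteration.
Context (R : realType) (n : nat) (dI dO : measure_display).
Context (I : measurableType dI) (Omega : measurableType dO).
Context (P : probability Omega R) (T : I -> 'rV[R]_n -> 'rV[R]_n).
Context (xi : {RV P >-> I}) (xis : nat -> {RV P >-> I}).
Context (X0 : {RV P >-> 'rV[R]_n}).
Hypothesis Phi_meas :
  measurable_fun [set: 'rV[R]_n * I] (fun p => T p.2 p.1).
Hypothesis xis_law : forall k A, measurable A ->
  distribution P (xis k) A = distribution P xi A.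
Hypothesis X0_xis_indep : forall k, mutually_independent P (sigma_X0_xi X0 xis k).

Local Notation X := (rfi T X0 xis).

Lemma measurable_rfi k : measurable_fun setT (X k).
Proof.
elim: k => [|k IHk] /=; first exact: measurable_funPT.
exact: (measurableT_comp Phi_meas
  (measurable_fun_pair IHk (measurable_funPT (xis k)))).
Qed.

HB.instance Definition _ k := isMeasurableFun.Build _ _ _ _ (X k) (measurable_rfi k).

Definition rfi_RV k : {RV P >-> 'rV[R]_n} := X k.

(** By induction on [k], for all [m] at once: [X k.+1] is a function of [X k] and [xis k], and the
    pair is independent of [xis k.+1] and its successors by the hypothesis at [k] with [m.+1]
    indices. *)
Lemma rfi_indep k m (A : set 'rV[R]_n) (B : nat -> set I) :
  measurable A -> (forall i, measurable (B i)) ->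
  P (X k @^-1` A `&` \bigcap_(i < m) xis (k + i) @^-1` B i) =
  (P (X k @^-1` A) * \prod_(i < m) P (xis (k + i) @^-1` B i))%E.
Proof.
elim: k m A B => [|k IHk] m A B mA mB.
  (* The families in [X0_xis_indep] contain at least [xis 0], so [m = 0] is treated apart. *)
  case: m => [|m]; first by rewrite bigcap_mkord !big_ord0 setIT mule1.
  pose D := [fset j in enum {: option 'I_m.+1}]%fset.
  pose E (j : option 'I_m.+1) := oapp (fun i : 'I_m.+1 => xis i @^-1` B i) (X0 @^-1` A) j.
  have := @X0_xis_indep m D E.
  have -> : \bigcap_(j in [set` D]) E j =
      X 0%N @^-1` A `&` \bigcap_(i < m.+1) xis (0 + i) @^-1` B i.
    apply/seteqP; split => w /=.
      move=> H; split; first by apply: (H None); rewrite /= in_fset mem_enum.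
      by move=> i /= im; apply: (H (Some (Ordinal im))); rewrite /= in_fset mem_enum.
    by move=> [H0 H] [i|] _ //=; exact: (H i (ltn_ord i)).
  have -> : (\prod_(j <- D) P (E j) =
      P (X 0%N @^-1` A) * \prod_(i < m.+1) P (xis (0 + i) @^-1` B i))%E.
    rewrite (perm_big (None :: map Some (enum 'I_m.+1))) /=.
      by rewrite big_cons big_map big_enum.
    apply: uniq_perm => [|/=|[i|]]; first exact: fset_uniq.
    - rewrite map_inj_uniq ?enum_uniq ?andbT; last by move=> ? ? [].
      by apply/mapP => -[].
    - by rewrite in_fset mem_enum !inE /= map_f// mem_enum.
    - by rewrite in_fset mem_enum !inE.
  apply=> -[i|] _ /=; first by exists (B i); rewrite ?setTI.
  by exists A; rewrite ?setTI.
pose E := \bigcap_(i < m) xis (k.+1 + i) @^-1` B i.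
have mE : measurable E.
  by apply: bigcap_measurableType => i _; exact: measurable_funPTI.
(* Prepending a set for [xis k] turns events on [m] indices from [k.+1] on into events on [m.+1]
   indices from [k] on. *)
pose cons_ (B0 : set I) i := if i is i'.+1 then B i' else B0.
have mcons B0 : measurable B0 -> forall i, measurable (cons_ B0 i).
  by move=> mB0 [|i] //=.
have capE B0 : \bigcap_(i < m.+1) xis (k + i) @^-1` cons_ B0 i =
    xis k @^-1` B0 `&` E.
  apply/seteqP; split => w /=.
    move=> H; split; first by have := H 0%N (ltn0Sn _); rewrite addn0.
    by move=> i /= im; have := H i.+1 im; rewrite /= addnS.
  by move=> [H0 H] [|i] im; rewrite /= ?addn0// addnS; exact: H.
have prodE B0 : (\prod_(i < m.+1) P (xis (k + i) @^-1` cons_ B0 i) =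
    P (xis k @^-1` B0) * \prod_(i < m) P (xis (k.+1 + i) @^-1` B i))%E.
  rewrite big_ord_recl /= addn0; congr (_ * _)%E.
  by apply: eq_bigr => i _; rewrite /= /bump /= add1n addnS.
have PE : P E = (\prod_(i < m) P (xis (k.+1 + i) @^-1` B i))%E.
  have := IHk m.+1 setT (cons_ setT) measurableT (mcons _ measurableT).
  by rewrite capE prodE !preimage_setT !setTI probability_setT !mul1e.
have rect A0 B0 : measurable A0 -> measurable B0 ->
    P (X k @^-1` A0 `&` xis k @^-1` B0 `&` E) =
    (P (X k @^-1` A0) * (P (xis k @^-1` B0) * P E))%E.
  move=> mA0 mB0; have := IHk m.+1 A0 (cons_ B0) mA0 (mcons _ mB0).
  by rewrite capE prodE PE setIA.
have rectT A0 B0 : measurable A0 -> measurable B0 ->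
    P (X k @^-1` A0 `&` xis k @^-1` B0 `&` setT) =
    (P (X k @^-1` A0) * (P (xis k @^-1` B0) * P setT))%E.
  move=> mA0 mB0; rewrite setIT probability_setT mule1.
  have := IHk 1%N A0 (fun=> B0) mA0 (fun=> mB0).
  by rewrite bigcap_mkord !big_ord1 addn0.
(* The preimage of [A] under [(x, i) |-> T i x] pulls back along [(X k, xis k)] to the event that
   [X k.+1] is in [A]. The rectangle rule is extended to it twice: with [E], and with [setT] to
   identify its product measure as a probability. *)
have mD : measurable ((fun p => T p.2 p.1) @^-1` A : set ('rV[R]_n * I)).
  by rewrite -[X in measurable X]setTI; exact: Phi_meas.
have := pair_distribution_restr (X := rfi_RV k) mE rect mD.
have := pair_distribution_restr (X := rfi_RV k) measurableT rectT mD.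
rewrite setIT probability_setT mule1 PE => <- stepE.
exact: stepE.
Qed.

Lemma distribution_rfi_pair k D : measurable D ->
  P ((fun w => (X k w, xis k w)) @^-1` D) =
  (distribution P (rfi_RV k) \x distribution P xi)%E D.
Proof.
move=> mD.
have rect A B : measurable A -> measurable B ->
    P (rfi_RV k @^-1` A `&` xis k @^-1` B `&` setT) =
    (P (rfi_RV k @^-1` A) * (P (xis k @^-1` B) * P setT))%E.
  move=> mA mB; rewrite setIT probability_setT mule1.
  have := @rfi_indep k 1%N A (fun=> B) mA (fun=> mB).
  by rewrite bigcap_mkord !big_ord1 addn0.
have := pair_distribution_restr measurableT rect mD.
rewrite setIT probability_setT mule1 => ->.
rewrite /product_measure1; apply: eq_integral => x _ /=.
by apply: xis_law; exact: measurable_xsection.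
Qed.

(** The pair [(X k, xis k)] has a product law, so Tonelli allows the fresh index to be averaged out
    first. *)
Lemma integral_rfi_step k (h : 'rV[R]_n -> \bar R) :
  measurable_fun [set: 'rV[R]_n] h -> (forall x, (0 <= h x)%E) ->
  (\int[P]_w h (X k.+1 w) =
   \int[P]_w \int[distribution P xi]_i h (T i (X k w)))%E.
Proof.
move=> mh h0.
have mhT : measurable_fun setT (fun p : 'rV[R]_n * I => h (T p.2 p.1)).
  exact: (measurableT_comp mh Phi_meas).
have mpair : measurable_fun setT (fun w => (X k w, xis k w)).
  by apply: measurable_fun_pair; [exact: measurable_rfi|exact: measurable_funPT].
have := ge0_integral_pushforward mpair P measurableT mhT (fun p _ => h0 _).
rewrite preimage_setT /comp /= => <-.
rewrite (eq_measure_integral (distribution P (rfi_RV k) \x distribution P xi)%E); last first.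
  by move=> D mD _; exact: distribution_rfi_pair.
rewrite fubini_tonelli1//= ge0_integral_distribution//.
  exact: measurable_fun_fubini_tonelli_F.
by move=> x; exact: integral_ge0.
Qed.

End random_function_iteration.

(** * Euclidean norm, [prox] and drift *)

Lemma enorm_ge0 (R : realType) (n : nat) (x : 'rV[R]_n) : 0 <= enorm x.
Proof. exact: sqrtr_ge0. Qed.

Lemma normr_le_enorm (R : realType) (n : nat) (x : 'rV[R]_n) : `|x| <= enorm x.
Proof.
rewrite [leLHS]/Num.norm /= mx_normrE; apply: bigmax_le; first exact: enorm_ge0.
move=> [i j] _ /=; rewrite (ord1 i) -sqrtr_sqr ler_sqrt; last first.
  by apply: sumr_ge0 => k _; exact: sqr_ge0.
by rewrite (bigD1 j)//= lerDl; apply: sumr_ge0 => k _; exact: sqr_ge0.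
Qed.

Lemma cvg_sum_seq (R : numFieldType) (V : normedModType R) (S J : Type)
    (F : set_system S) {FF : Filter F} (r : seq J) (f : J -> S -> V) (l : J -> V) :
  (forall j, f j s @[s --> F] --> l j) ->
  \sum_(j <- r) f j s @[s --> F] --> \sum_(j <- r) l j.
Proof.
move=> fl; elim: r => [|j r IHr].
  rewrite big_nil (_ : (fun _ => _) = cst 0); first exact: cvg_cst.
  by apply/funext => s; rewrite big_nil.
rewrite big_cons (_ : (fun _ => _) = (fun s => f j s + \sum_(j <- r) f j s)).
  exact: cvgD.
by apply/funext => s; rewrite big_cons.
Qed.

Lemma continuous_enormB (R : realType) (n : nat) (y : 'rV[R]_n) :
  continuous (fun x : 'rV[R]_n => enorm (x - y)).
Proof.
move=> x; suff H : \sum_(j < n) (z - y) ord0 j ^+ 2 @[z --> x] -->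
    \sum_(j < n) (x - y) ord0 j ^+ 2.
  exact: (continuous_cvg _ (@sqrt_continuous R _) H).
apply: (@cvg_sum_seq _ _ _ _ _ (nbhs_filter x) _
  (fun j (z : 'rV[R]_n) => (z - y) ord0 j ^+ 2)) => j.
apply: (continuous_cvg _ (@exprn_continuous _ 2 _)); rewrite !mxE.
rewrite (_ : (fun _ => _) = (fun z : 'rV[R]_n => z ord0 j - y ord0 j)); last first.
  by apply/funext => z; rewrite !mxE.
by apply: cvgB; [exact: coord_continuous|exact: cvg_cst].
Qed.

Lemma paracontractive_le (R : realType) (n : nat) (f : 'rV[R]_n -> 'rV[R]_n) x y :
  paracontractive f -> Fix f y -> enorm (f x - y) <= enorm (x - y).
Proof.
move=> [_ fP] fy; have [->//|/eqP fx] := eqVneq (f x) x.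
exact/ltW/fP.
Qed.

(** A bounded decreasing function of the distance to [y]: its mean is finite for every initial law,
    whereas the distance itself may have infinite mean. *)
Definition prox (R : realType) (n : nat) (y x : 'rV[R]_n) : R :=
  (1 + enorm (x - y))^-1.

Section prox.
Context (R : realType) (n : nat).
Implicit Types x y : 'rV[R]_n.

Lemma prox_gt0 y x : 0 < prox y x.
Proof. by rewrite invr_gt0 ltr_pwDl// enorm_ge0. Qed.

Lemma prox_ge0 y x : 0 <= prox y x.
Proof. exact/ltW/prox_gt0. Qed.

Lemma prox_le1 y x : prox y x <= 1.
Proof. by rewrite invf_le1 ?lerDl ?ltr_pwDl ?enorm_ge0. Qed.

Lemma continuous_prox y : continuous (prox y).
Proof.
move=> x; apply: (cvgV _ (cvgD (cvg_cst (1 : R)) (@continuous_enormB R n y x))).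
by rewrite gt_eqF// ltr_pwDl// enorm_ge0.
Qed.

Lemma measurable_prox y : measurable_fun setT (prox y).
Proof. by apply: continuous_measurable_mx; exact: continuous_prox. Qed.

Lemma paracontractive_prox (f : 'rV[R]_n -> 'rV[R]_n) x y :
  paracontractive f -> Fix f y -> prox y x <= prox y (f x).
Proof.
move=> fP fy; rewrite lef_pV2 ?posrE ?ltr_pwDl ?enorm_ge0// lerD2l.
exact: paracontractive_le.
Qed.

Lemma paracontractive_prox_eq (f : 'rV[R]_n -> 'rV[R]_n) x y :
  paracontractive f -> Fix f y -> prox y (f x) = prox y x -> Fix f x.
Proof.
move=> [_ fP] fy /invr_inj/addrI fxy; apply: contrapT => fx.
by have := fP _ _ fx fy; rewrite fxy ltxx.
Qed.

End prox.

(* If [y] is almost surely fixed, [prox y] increases in mean along the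
   iteration, and strictly so outside the set of almost surely fixed points. *)
Definition drift (R : realType) (n : nat) dI (I : measurableType dI)
    (lam : probability I R) (T : I -> 'rV[R]_n -> 'rV[R]_n) (y x : 'rV[R]_n) : R :=
  fine (\int[lam]_i (prox y (T i x))%:E) - prox y x.

Section drift.
Context (R : realType) (n : nat) dI (I : measurableType dI).
Context (lam : probability I R) (T : I -> 'rV[R]_n -> 'rV[R]_n).
Hypothesis Phi_meas :
  measurable_fun [set: 'rV[R]_n * I] (fun p => T p.2 p.1).
Hypothesis T_para : forall i, paracontractive (T i).
Variable y : 'rV[R]_n.
Hypothesis y_fix : {ae lam, forall i, Fix (T i) y}.

Local Notation Q x := (\int[lam]_i (prox y (T i x))%:E)%E.

Let mT x : measurable_fun setT (fun i => T i x).
Proof. exact: (measurable_fun_pair2 x Phi_meas). Qed.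

Let mproxT x : measurable_fun setT (fun i => prox y (T i x)).
Proof. exact: (measurableT_comp (measurable_prox y) (mT x)). Qed.

Let mEproxT x : measurable_fun setT (fun i => (prox y (T i x))%:E).
Proof. exact/measurable_EFinP. Qed.

Let int_proxT x : lam.-integrable setT (EFin \o (fun i => prox y (T i x))).
Proof.
apply: (le_integrable measurableT (mEproxT x) _
  (finite_measure_integrable_cst lam (1 : R) measurableT)).
by move=> i _ /=; rewrite lee_fin ger0_norm ?prox_ge0// normr1 prox_le1.
Qed.

Let int_cst (r : R) : (\int[lam]_i r%:E = r%:E)%E.
Proof.
by apply: etrans (integral_cst lam measurableT r%:E) _; rewrite [X in (_ * X)%E]probability_setT mule1.
Qed.

Lemma mean_prox_fin x : Q x = (fine (Q x))%:E.
Proof. by rewrite fineK//; exact: integrable_fin_num (int_proxT x). Qed.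

Lemma measurable_mean_prox : measurable_fun [set: 'rV[R]_n] (fun x => Q x).
Proof.
have mf : measurable_fun [set: 'rV[R]_n * I]
    (fun p : 'rV[R]_n * I => (prox y (T p.2 p.1))%:E).
  by apply/measurable_EFinP; exact: (measurableT_comp (measurable_prox y) Phi_meas).
by apply: (measurable_fun_fubini_tonelli_F _ mf) => p; rewrite lee_fin prox_ge0.
Qed.

Lemma measurable_drift : measurable_fun setT (drift lam T y).
Proof.
apply: measurable_funB; last exact: measurable_prox.
exact: (measurableT_comp (fine_measurable measurableT) measurable_mean_prox).
Qed.

Lemma drift_ge0 x : 0 <= drift lam T y x.
Proof.
rewrite subr_ge0 -lee_fin -mean_prox_fin.
rewrite -[leLHS]int_cst.
apply: ae_ge0_le_integral => //.
- by move=> i _; rewrite lee_fin prox_ge0.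
- by move=> i _; rewrite lee_fin prox_ge0.
- apply: filterS y_fix => i yi _; rewrite lee_fin.
  exact: paracontractive_prox.
Qed.

(** An almost everywhere nonnegative integrand with zero integral vanishes almost everywhere, and
    equality in [paracontractive_prox] forces a fixed point. *)
Lemma drift_eq0 x : drift lam T y x = 0 -> {ae lam, forall i, Fix (T i) x}.
Proof.
move=> dx.
pose f i := prox y (T i x) - prox y x.
have mf : measurable_fun setT (fun i => (f i)%:E).
  by apply/measurable_EFinP; exact: measurable_funB.
have int_f : (\int[lam]_i (f i)%:E = 0)%E.
  rewrite (integralB_EFin measurableT (int_proxT x)
    (finite_measure_integrable_cst lam (prox y x) measurableT)).
  rewrite mean_prox_fin int_cst.
  by rewrite -EFinB -/(drift lam T y x) dx.
have int_absf : (\int[lam]_i `|(f i)%:E| = 0)%E.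
  rewrite -int_f; apply: ae_eq_integral => //; first exact: measurableT_comp.
  apply: filterS y_fix => i yi _ /=; rewrite ger0_norm// subr_ge0.
  exact: paracontractive_prox.
have := (ae_eq_integral_abs lam measurableT mf).1 int_absf.
apply: filterS2 y_fix => i yi /(_ Logic.I) /= [/eqP]; rewrite subr_eq0 => /eqP.
exact: paracontractive_prox_eq.
Qed.

(** Dominated convergence with bound 1, using continuity of each [T i]. *)
Lemma cvg_drift (u : nat -> 'rV[R]_n) x : u k @[k --> \oo] --> x ->
  drift lam T y (u k) @[k --> \oo] --> drift lam T y x.
Proof.
move=> ux; apply: cvgB; last exact: (continuous_cvg _ (@continuous_prox R n y x) ux).
apply: fine_cvg; rewrite -mean_prox_fin.
apply: (dominated_cvg measurableT (g := fun=> 1%E)) => //.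
- move=> i _; apply: cvg_EFin; first exact: nearW.
  apply: (continuous_cvg _ (@continuous_prox R n y (T i x))).
  exact: (continuous_cvg _ ((T_para i).1 x) ux).
- exact: (finite_measure_integrable_cst lam (1 : R) measurableT).
- by move=> k i _ /=; rewrite lee_fin ger0_norm ?prox_ge0// prox_le1.
Qed.

End drift.

(** * Fejer monotone sequences *)

(** Monotone distance to [y] keeps the sequence in a compact ball, which yields a cluster point; it
    lies in [C], so the distance to it is monotone too and is arbitrarily small at some index, hence
    from there on. *)
Lemma fejer_cvg (R : realType) (n : nat) (C : set 'rV[R]_n)
    (u : nat -> 'rV[R]_n) (y : 'rV[R]_n) :
  C y ->
  (forall x, C x -> forall k, enorm (u k.+1 - x) <= enorm (u k - x)) ->
  (forall (phi : nat -> nat) x, (forall j, j <= phi j)%N ->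
    u (phi j) @[j --> \oo] --> x -> C x) ->
  exists2 x, C x & u k @[k --> \oo] --> x.
Proof.
move=> Cy u_le u_cluster.
have u_mono x k m : C x -> (k <= m)%N -> enorm (u m - x) <= enorm (u k - x).
  by move=> Cx /subnK <-; elim: (m - k)%N => // j; apply: le_trans; exact: u_le.
pose K := (fun x => enorm (x - y)) @^-1` [set t | t <= enorm (u 0%N - y)].
have K_compact : compact K.
  apply: bounded_closed_compact.
    exists (enorm (u 0%N - y) + `|y|); split; first exact: num_real.
    move=> M ltM x Kx; apply/ltW/(le_lt_trans _ ltM).
    rewrite -[x](subrK y); apply: (le_trans (ler_normD _ _)).
    by rewrite lerD2r; apply: le_trans Kx; exact: normr_le_enorm.
  by apply: preimage_closed => [x _|]; [exact: continuous_enormB|exact: closed_le].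
have uK : \forall k \near \oo, K (u k) by apply: nearW => k; exact: u_mono.
have [x [_ clx]] := K_compact (u k @[k --> \oo]) _ uK.
have near_x j B : nbhs x B -> exists k, (j <= k)%N /\ B (u k).
  move=> xB; have [|_ [[k jk <-] Bk]] := clx (u @` [set k | (j <= k)%N]) B _ xB.
    by exists j => // k jk; exists k.
  by exists k.
have Cx : C x.
  (* The chosen indices need not increase: [j <= phi j] is enough for [phi] to tend to infinity. *)
  have [phi phiP] := choice (fun j =>
    near_x j _ (nbhsx_ballx x j.+1%:R^-1 (ltac:(by [])))).
  apply: (u_cluster phi) => [j|]; first exact: (phiP j).1.
  apply/cvg_ballP => e e0.
  apply: filterS (near_infty_natSinv_lt (PosNum e0)) => j /= je.
  by apply: (le_ball (ltW je)); exact: (phiP j).2.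
exists x => //; apply/cvgrPdist_lt => e e0.
have enorm_lt : \forall z \near x, enorm (z - x) < e.
  have : enorm (x - x) < e.
    by rewrite subrr /enorm big1 ?sqrtr0// => j _; rewrite mxE expr0n.
  by move=> /(cvgr_lt _ (@continuous_enormB R n x x)).
have [k [_ uk]] := near_x 0%N _ enorm_lt.
exists k => // m km; apply: le_lt_trans uk; apply: le_trans (u_mono _ _ _ Cx km).
by rewrite distrC; exact: normr_le_enorm.
Qed.

(** * Almost sure convergence of the iteration *)

Lemma ae_probability1 (R : realType) d (S : measurableType d)
    (P : probability S R) (A : set S) : measurable A ->
  P A = 1%E <-> {ae P, forall x, A x}.
Proof.
move=> mA; have mAC := measurableC mA.
have PAC := probability_setC P mA; split=> [PA1|].
  exists (~` A); split => //.
  by rewrite [LHS]PAC PA1 subee.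
move=> /(negligibleP P mAC) => PA0; apply/eqP; rewrite eq_le probability_le1//=.
by rewrite -sube_le0 -PAC PA0.
Qed.

(** The expected drifts telescope to a difference of means of [prox], so their sum is at most 1. By
    monotone convergence the random series of drifts has finite mean, hence is almost surely finite,
    and its terms tend to 0. *)
Lemma drift_rfi_cvg0 (R : realType) (n : nat)
    (dI dO : measure_display)
    (I : measurableType dI) (Omega : measurableType dO)
    (P : probability Omega R)
    (T : I -> 'rV[R]_n -> 'rV[R]_n)
    (xi : {RV P >-> I}) (xis : nat -> {RV P >-> I}) (X0 : {RV P >-> 'rV[R]_n})
    (Phi_meas : measurable_fun [set: 'rV[R]_n * I] (fun p => T p.2 p.1))
    (xis_law : forall k A, measurable A ->
      distribution P (xis k) A = distribution P xi A)
    (X0_xis_indep : forall k, mutually_independent P (sigma_X0_xi X0 xis k))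
    (T_para : forall i, paracontractive (T i)) (y : 'rV[R]_n)
    (y_fix : {ae distribution P xi, forall i, Fix (T i) y}) :
  {ae P, forall w,
    drift (distribution P xi) T y (rfi T X0 xis k w) @[k --> \oo] --> 0}.
Proof.
pose lam : probability I R := distribution P xi; pose X := rfi T X0 xis.
pose d k w := drift lam T y (X k w).
have d_ge0 k w : 0 <= d k w by exact: drift_ge0.
have mX k : measurable_fun setT (X k) by exact: measurable_rfi.
have md k : measurable_fun setT (fun w => (d k w)%:E).
  apply/measurable_EFinP.
  exact: (measurableT_comp (measurable_drift lam Phi_meas y) (mX k)).
have mp k : measurable_fun setT (fun w => (prox y (X k w))%:E).
  apply/measurable_EFinP; exact: (measurableT_comp (measurable_prox y) (mX k)).
have stepE k : (\int[P]_w (prox y (X k.+1 w))%:E =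
    \int[P]_w (prox y (X k w))%:E + \int[P]_w (d k w)%:E)%E.
  rewrite -ge0_integralD//; last 2 first.
  - by move=> w _; rewrite lee_fin prox_ge0.
  - by move=> w _; rewrite lee_fin.
  rewrite (integral_rfi_step Phi_meas xis_law X0_xis_indep k
    (h := fun x => (prox y x)%:E)); last 2 first.
  - by apply/measurable_EFinP; exact: measurable_prox.
  - by move=> x; rewrite lee_fin prox_ge0.
  apply: eq_integral => w _; rewrite mean_prox_fin// -EFinD.
  by rewrite /d /drift addrC subrK.
have prox_le k : (\int[P]_w (prox y (X k w))%:E <= 1)%E.
  have <- : (\int[P]_w cst 1 w = 1 :> \bar R)%E.
    by rewrite integral_cst// mul1e; exact: probability_setT.
  apply: ge0_le_integral => //.
  - by move=> w _; rewrite lee_fin prox_ge0.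
  - by move=> w _; rewrite lee_fin prox_le1.
have sumE N : (\int[P]_w (prox y (X 0%N w))%:E +
    \sum_(0 <= k < N) \int[P]_w (d k w)%:E = \int[P]_w (prox y (X N w))%:E)%E.
  elim: N => [|N IHN]; first by rewrite big_geq// adde0.
  by rewrite big_nat_recr//= addeA IHN stepE.
have sum_le : (\sum_(0 <= k <oo) \int[P]_w (d k w)%:E <= 1)%E.
  apply: lime_le.
    by apply: is_cvg_nneseries => k _ _; apply: integral_ge0 => w _; rewrite lee_fin.
  apply: nearW => N; apply: le_trans (prox_le N); rewrite -sumE leeDr//.
  by apply: integral_ge0 => w _; rewrite lee_fin prox_ge0.
have d_ge0E k w : setT w -> (0 <= (d k w)%:E)%E by move=> _; rewrite lee_fin.
have int_sum : P.-integrable setT (fun w => \sum_(0 <= k <oo) (d k w)%:E)%E.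
  apply/integrableP; split.
    apply: (@ge0_emeasurable_sum _ _ _ _ (fun k w => (d k w)%:E) xpredT) => // k w _ _.
    exact: d_ge0E.
  rewrite (eq_integral (fun w => \sum_(0 <= k <oo) (d k w)%:E)%E); last first.
    by move=> w _; rewrite gee0_abs// nneseries_ge0// => k _ _; exact: d_ge0E.
  rewrite integral_nneseries//; exact: le_lt_trans sum_le (ltry _).
apply: filterS (integrable_ae measurableT int_sum) => w /(_ Logic.I) dw.
have d_fin : (\sum_(0 <= k <oo) (d k w)%:E < +oo)%E by rewrite ltey_eq dw.
exact: cvg_series_cvg_0 (nnseries_is_cvg (d_ge0^~ w) d_fin).
Qed.

Lemma closed_Fix (R : realType) (n : nat) (f : 'rV[R]_n -> 'rV[R]_n) :
  continuous f -> closed (Fix f).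
Proof.
move=> cf; rewrite (_ : Fix f = (fun x => f x - x) @^-1` [set 0]); last first.
  by apply/seteqP; split => x /=; [move=> ->; rewrite subrr|move/subr0_eq].
apply: preimage_closed => [x _|].
  by apply: continuousB; [exact: cf|exact: cvg_id].
exact: closed_set1_mx.
Qed.

Theorem theorem3p6 (R : realType) (n : nat)
    (dI dO : measure_display)
    (I : measurableType dI) (Omega : measurableType dO)
    (P : probability Omega R)
    (T : I -> 'rV[R]_n -> 'rV[R]_n)
    (xi : {RV P >-> I}) (xis : nat -> {RV P >-> I})
    (mu : probability 'rV[R]_n R) (X0 : {RV P >-> 'rV[R]_n})
    (Phi_meas : measurable_fun [set: 'rV[R]_n * I] (fun p => T p.2 p.1))
    (xis_law : forall k A, measurable A ->
      distribution P (xis k) A = distribution P xi A)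
    (xis_indep :
      mutually_independent P (fun k => g_sigma_algebra_preimage (xis k)))
    (X0_law : forall A, measurable A -> distribution P X0 A = mu A)
    (X0_xis_indep : forall k, mutually_independent P (sigma_X0_xi X0 xis k))
    (T_para : forall i, paracontractive (T i))
    (C_neq0 : common_fix P T xi !=set0) :
  exists Xmu : {RV P >-> 'rV[R]_n},
    (forall w, common_fix P T xi (Xmu w)) /\
    {ae P, forall w, rfi T X0 xis k w @[k --> \oo] --> Xmu w}.
Proof.
set C := common_fix P T xi; pose lam : probability I R := distribution P xi.
have mFix x : measurable [set i | Fix (T i) x].
  rewrite -[X in measurable X]setTI.
  exact: (measurable_fun_pair2 x Phi_meas) (measurable_set1_mx x).
have CE x : C x <-> {ae lam, forall i, Fix (T i) x}.
  exact: (ae_probability1 lam (mFix x)).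
have C_fix k x : C x -> {ae P, forall w, Fix (T (xis k w)) x}.
  move=> Cx; have m : measurable (xis k @^-1` [set i | Fix (T i) x]).
    exact: measurable_funPTI.
  apply/(ae_probability1 P m); rewrite -[LHS]/(distribution P (xis k) _) xis_law//.
have [y Cy] := C_neq0.
have [s sC s_dense] := closed_cover_sequence_mx C_neq0.
have drift0 := drift_rfi_cvg0 Phi_meas xis_law X0_xis_indep T_para ((CE y).1 Cy).
(* Only countably many pairs [(k, j)] occur, so a single null set serves them all. *)
have s_fix : {ae P, forall w, forall k j, Fix (T (xis k w)) (s j)}.
  by apply: ae_foralln => k; apply: ae_foralln => j; exact: C_fix (sC j).
have : {ae P, forall w,
    exists2 x, C x & rfi T X0 xis k w @[k --> \oo] --> x}.
  apply: filterS2 drift0 s_fix => w dw sw.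
  (* Fixed-point sets of continuous maps are closed, so fixing every [s j] entails fixing all of
     [C]. *)
  have Fw k x : C x -> Fix (T (xis k w)) x.
    exact: (s_dense _ (closed_Fix (T_para (xis k w)).1) (sw k)).
  apply: (fejer_cvg Cy) => [x Cx k|phi x phi_ge ux].
    by apply: paracontractive_le => //; exact: Fw.
  apply/CE; apply: (drift_eq0 Phi_meas T_para ((CE y).1 Cy)).
  have phi_oo : phi j @[j --> \oo] --> \oo.
    by move=> A [N _ NA]; exists N => // k Nk; apply: NA; exact: leq_trans (phi_ge k).
  (* Along [phi] the drift tends both to its value at [x] and to 0, so [x] has zero drift. *)
  have := cvg_drift (lam := lam) Phi_meas T_para ux.
  move=> /(_ y) /cvg_unique; apply.
    exact: norm_hausdorff.
  exact: (cvg_comp _ _ phi_oo dw).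
move=> [N [mN PN0 subN]].
(* On the measurable null set [N] the iterates are replaced by the constant [y] in [C], so that the
   limit exists and lies in [C] everywhere and is measurable. *)
pose Z k w := if w \in N then y else rfi T X0 xis k w.
have mZ k : measurable_fun setT (Z k).
  apply: measurable_fun_ifT => //; last exact: measurable_rfi.
  by apply: (measurable_fun_bool true); rewrite setTI preimage_mem_true.
have Z_cvg w : exists x, C x /\ Z k w @[k --> \oo] --> x.
  have [wN|wN] := pselect (N w).
    by exists y; rewrite /Z mem_set//; split => //; exact: cvg_cst.
  have [x Cx ux] : exists2 x, C x & rfi T X0 xis k w @[k --> \oo] --> x.
    by apply: contrapT => nw; apply: wN; exact: subN.
  by exists x; rewrite /Z memNset.
have [Xlim XlimP] := choice Z_cvg.
have mXlim : measurable_fun setT Xlim.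
  by apply: measurable_fun_cvg_mx mZ _ => w; exact: (XlimP w).2.
pose Xmu : {RV P >-> 'rV[R]_n} :=
  HB.pack Xlim (isMeasurableFun.Build _ _ _ _ Xlim mXlim).
exists Xmu; split => [w|]; first exact: (XlimP w).1.
exists N; split => // w /= nw; apply: contrapT => wN; apply: nw.
by have := (XlimP w).2; rewrite /Z memNset.
Qed.
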